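(* Let $G$ be the free semigroup generated by continuous maps $f_1,\dots,f_m$ acting on a compact metric space $(X,d)$, and let $\mu$ be a Borel probability measure on $X$ with full support. If $\mu$ satisfies the weak entropy-doubling condition of free semigroup actions, then $h_{cor}(G,\mu,0)$ exists (i.e. $\overline{h}_{cor}(G,\mu,0)=\underline{h}_{cor}(G,\mu,0)$) and $$h_{top}(G)=h_{cor}(G,\mu,0).$$
   Context: Setting. $(X,d)$ is a compact metric space, $f_1,\dots,f_m:X\to X$ are continuous, $G$ is the free semigroup generated by $\{f_1,\dots,f_m\}$ acting on $X$. Fix a probability vector $p=(p_1,\dots,p_m)$ with all $p_i>0$ and $\sum_i p_i=1$; let $\Sigma_m^+=\{1,\dots,m\}^{\mathbb{N}}$ and let $\mathbb{P}$ be the Bernoulli (product) measure on $\Sigma_m^+$ generated by $p$. For $\omega=(i_1,i_2,\dots)\in\Sigma_m^+$ put $f_{\omega,0}=\mathrm{id}$ and $f_{\omega,n}=f_{i_n}\circ\cdots\circ f_{i_1}$ for $n\ge1$. For $k\ge 1$ put $$d^G_{\omega,k}(x,y)=\max_{0\le i\le k-1} d(f_{\omega,i}(x),f_{\omega,i}(y)),\qquad B^G_{\omega,k}(x,\varepsilon)=\{y\in X: d^G_{\omega,k}(x,y)\le\varepsilon\}.$$ Weak entropy-doubling condition of free semigroup actions: for all sufficiently small $\varepsilon>0$, $$\limsup_{k\to+\infty}\frac1k\log\sup_{x\in X}\frac{\mu(B^G_{\omega,k}(x,2\varepsilon))}{\mu(B^G_{\omega,k}(x,\varepsilon))}=0\quad\text{for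 }\mathbb{P}\text{-a.e. }\omega\in\Sigma_m^+.$$ Topological entropy. A set $E\subseteq X$ is $(\omega,k,\varepsilon)$-separated if $d^G_{\omega,k}(x,y)>\varepsilon$ for all distinct $x,y\in E$; $E(\omega,k,\varepsilon)$ denotes such a set of largest cardinality. Then $$h_{top}(G)=\lim_{\varepsilon\to0}\liminf_{k\to+\infty}\frac1k\int_{\Sigma_m^+}\log\sharp E(\omega,k,\varepsilon)\,d\mathbb{P}(\omega).$$ Correlation entropy of order 0. $$\overline{h}_{cor}(G,\mu,0)=\lim_{\varepsilon\to0}\limsup_{k\to+\infty}\frac1k\int_{\Sigma_m^+}\log\Big(\int_X\mu(B^G_{\omega,k}(x,\varepsilon))^{-1}\,d\mu(x)\Big)d\mathbb{P}(\omega),$$ and $\underline{h}_{cor}(G,\mu,0)$ is defined with $\liminf_{k\to+\infty}$ in place of $\limsup_{k\to+\infty}$; when they coincide the common value is $h_{cor}(G,\mu,0)$. *)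

(* Defs.v *)
From HB Require Import structures.
From mathcomp Require Import all_boot all_order all_algebra.
From mathcomp Require Import finmap.
From mathcomp Require Import all_classical all_reals all_analysis.

Set Implicit Arguments.
Unset Strict Implicit.
Unset Printing Implicit Defensive.

Import Order.TTheory GRing.Theory Num.Theory.
Import numFieldNormedType.Exports.

Local Open Scope classical_set_scope.
Local Open Scope ring_scope.

(* The library's measurable types are pointed, so a metric space that is to
   carry a Borel measure has to be pointed as well.  The point is not used by
   any definition below, and a space with a probability measure is nonempty. *)
#[short(type="pmetricType")]
HB.structure Definition PointedMetric (R : numDomainType) :=
  {M of Pointed M & Metric R M}.

Notation borelType X := (g_sigma_algebraType (@open X)).

HB.instance Definition _ (m : nat) := isPointed.Build 'I_m.+1 ord0.

Definition full_support (R : realType) (X : pmetricType R)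
    (mu : probability (borelType X) R) : Prop :=
  forall U : set X, open U -> U !=set0 -> (0 < mu U)%E.

(* The alphabet is 'I_m.+1, i.e. there are m.+1 >= 1 generators, and w 0 is the
   first letter i_1 of the word (i_1, i_2, ...). *)
Definition cylinder (m : nat) (a : seq 'I_m.+1) : set (nat -> 'I_m.+1) :=
  [set w | forall j, (j < size a)%N -> w j = nth ord0 a j].

Notation words m := (g_sigma_algebraType (range (@cylinder m))).

(* By uniqueness of extension from the pi-system of cylinders, at most one
   probability satisfies this: the product measure p^{\otimes nat}. *)
Definition is_bernoulli (R : realType) (m : nat) (p : 'I_m.+1 -> R)
    (P : probability (words m) R) : Prop :=
  forall a : seq 'I_m.+1, P (cylinder a) = (\prod_(i <- a) p i)%:E.

Section FreeSemigroupAction.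
Context {R : realType} {X : pmetricType R} {m : nat}.
Variable f : 'I_m.+1 -> X -> X.
Implicit Types (w : nat -> 'I_m.+1) (n k : nat) (x y : X) (eps : R).

Fixpoint fword w n : X -> X :=
  if n is n'.+1 then f (w n') \o fword w n' else id.

(* Distances are nonnegative, so 0 is a neutral initial value for the max. *)
Definition dG w k x y : R :=
  \big[Num.max/0]_(i < k) mdist (fword w i x) (fword w i y).

Definition BG w k x eps : set X := [set y | dG w k x y <= eps].

Definition separated_set w k eps (E : {fset X}) : Prop :=
  forall x y, x \in E -> y \in E -> x != y -> eps < dG w k x y.

(* On a compact X the separated sets have bounded cardinality and this
   supremum is a maximum. *)
Definition max_separated w k eps : \bar R :=
  ereal_sup [set ((#|` E|)%:R)%:E | E in separated_set w k eps].

Variable P : probability (words m) R.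
Variable mu : probability (borelType X) R.

Local Open Scope ereal_scope.

Definition weak_entropy_doubling : Prop :=
  \forall eps \near (0 : R)^'+,
    {ae P, forall w,
      limn_esup (fun k => (k%:R^-1)%:E *
        lne (ereal_sup [set mu (BG w k x (2 * eps)) / mu (BG w k x eps)
                       | x in [set: X]])) = 0}.

(* The limits in eps below are limits of monotone functions in \bar R. *)
Definition htop : \bar R :=
  lim (limn_einf (fun k => (k%:R^-1)%:E *
         \int[P]_w lne (max_separated w k eps)) @[eps --> (0 : R)^'+]).

Definition cor_integral k eps : \bar R :=
  \int[P]_w lne (\int[mu]_x (mu (BG w k x eps))^-1).

Definition hcor_upper : \bar R :=
  lim (limn_esup (fun k => (k%:R^-1)%:E * cor_integral k eps)
         @[eps --> (0 : R)^'+]).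

Definition hcor_lower : \bar R :=
  lim (limn_einf (fun k => (k%:R^-1)%:E * cor_integral k eps)
         @[eps --> (0 : R)^'+]).

Definition is_hcor (h : \bar R) : Prop := hcor_upper = h /\ hcor_lower = h.

End FreeSemigroupAction.

(* Main.v *)
Require Import Defs.
From HB Require Import structures.
From mathcomp Require Import all_boot all_order all_algebra.
From mathcomp Require Import finmap.
From mathcomp Require Import all_classical all_reals all_analysis.
From mathcomp Require Import measurable_realfun.

Set Implicit Arguments.
Unset Strict Implicit.
Unset Printing Implicit Defensive.

Import Order.TTheory GRing.Theory Num.Theory.
Import numFieldNormedType.Exports.

Local Open Scope classical_set_scope.
Local Open Scope ring_scope.

(** For a word [w], let [S] be the largest cardinality of a separated set
    ([max_separated]), [I] the integral of the inverse masses of Bowen balls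
    ([inverse_mass]) and [D] the supremum of the ratios of masses of concentric
    Bowen balls, one of twice the radius of the other ([doubling_ratio]).  Three
    comparisons give the theorem.

    - [I(2 eps) <= S(eps)].  The Bowen balls of radius [eps] around a maximal
      separated set cover the space, and on each of them the inverse mass of
      the ball of radius [2 eps] is at most the inverse mass of the covering
      ball, so each contributes at most 1 to the integral
      ([inverse_mass_le_max_separated]).

    - [S(2 eps) <= D(eps) * I(eps)].  Around a [2 eps]-separated set the balls of
      radius [eps] are disjoint, and for a point of one of them the inverse mass
      of its own ball of radius [eps] is at least that of the concentric ball of
      radius [2 eps], so each disjoint ball contributes at least [1 / D(eps)]
      ([max_separated_le_doubling]).  The average of [(1/k) log D] over words need
      not tend to 0, because the doubling hypothesis is pointwise in the word.
      But [(1/k) log S] is bounded by the logarithm of a covering number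
      and [log I] is nonnegative, so in
      [(1/k) log S(2 eps) <= (1/k) log I(eps) + (1/k) log D(eps)] the last term
      can be truncated at this bound.  The truncations tend to 0 almost surely
      and dominated convergence applies ([truncated_doubling_cvg0],
      [liminf_growth_le_cor]).

    - The upper growth rate of the averaged [log S] at scale [2 eps] is at most
      its lower growth rate at scale [eps] ([limsup_growth_le_liminf]).
      Partitions of the space into classes of small Bowen diameter are
      submultiplicative along a word: a partition for the first [n] letters and
      one for the shifted word refine to a partition for the whole.  A maximal
      [eps]-separated set provides such a partition at scale [2 eps], a partition
      bounds all separated sets, and the Bernoulli measure is shift invariant;
      cutting a long word into blocks of [n] letters bounds the growth rate by
      the average over one block ([separated_growth_blocks]).

    Hence the lower growth rate of separated sets, a monotone function of the
    scale, squeezes both correlation rates between two of its rescalings, and all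
    limits at scale 0 agree.

    Every function of the word that is integrated depends on finitely many
    letters, which makes it measurable and turns shift invariance into an identity
    between finite sums ([measurable_prefix], [integral_prefix]).  Integrals over
    the space are estimated by simple functions only, so that the measurability of
    the mass of a Bowen ball in its centre never has to be established. *)

(** * Upper and lower limits of extended real sequences *)

Section ExtendedRealLimits.
Context {R : realType}.
Implicit Types (u v : (\bar R)^nat) (l : \bar R).
Local Open Scope ereal_scope.

(** The slack [d] lets comparisons that hold only up to a vanishing error pass to
    the upper limit, and a constant sequence on one side bounds the limit itself. *)
Lemma le_limn_esup u v :
  (forall d : R, (0 < d)%R -> \forall k \near \oo, u k <= v k + d%:E) ->
  limn_esup u <= limn_esup v.
Proof.
move=> uv; apply/lee_addgt0Pr => d d0.
rewrite -leeBlDr//; apply: le_ereal_inf_tmp => _ [V FV <-].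
rewrite leeBlDr//.
have FW : \oo (V `&` [set k | u k <= v k + d%:E]).
  by apply: filterI => //; exact: uv.
apply: (@le_trans _ _ (ereal_sup (u @` (V `&` [set k | u k <= v k + d%:E])))).
  by apply: ereal_inf_lbound; exists (V `&` [set k | u k <= v k + d%:E]).
apply: ge_ereal_sup => _ [k [Vk /= uvk] <-].
by rewrite (le_trans uvk)// leeD2r//; apply: ereal_sup_ubound; exists k.
Qed.

Lemma le_limn_einf u v :
  (forall d : R, (0 < d)%R -> \forall k \near \oo, u k <= v k + d%:E) ->
  limn_einf u <= limn_einf v.
Proof.
move=> uv; rewrite /limn_einf leeN2; apply: le_limn_esup => d d0.
apply: filterS (uv d d0) => k uvk /=.
by rewrite -leeBlDr// -fin_num_oppeD// leeN2.
Qed.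

Lemma cvg_at_right_scale (g : R -> \bar R) (c : R) l : (0 < c)%R ->
  g e @[e --> 0%R^'+] --> l -> g (c * e)%R @[e --> 0%R^'+] --> l.
Proof.
move=> c0 gl; apply: cvg_comp gl.
move=> A [r /= r0 rA]; exists (r / c)%R => /=; first by rewrite divr_gt0.
move=> e /=; rewrite sub0r normrN => er e0; apply: rA => /=; last by rewrite mulr_gt0.
by rewrite sub0r normrN normrM (gtr0_norm c0) mulrC -ltr_pdivlMr.
Qed.

End ExtendedRealLimits.

(** * Bowen distances, partitions and separated sets *)

Section BowenDistance.
Context {R : realType} {X : pmetricType R} {m : nat}.
Variable f : 'I_m.+1 -> X -> X.
Implicit Types (w : nat -> 'I_m.+1) (n k : nat) (x y : X) (eps : R).

Lemma dG_leP w k x y eps : 0 <= eps ->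
  (dG f w k x y <= eps) <->
  (forall i, (i < k)%N -> mdist (fword f w i x) (fword f w i y) <= eps).
Proof.
move=> e0; split => [/bigmax_leP[_ h] i ik|h]; first exact: (h (Ordinal ik)).
by apply/bigmax_leP; split => // i _; exact: h.
Qed.

Lemma dG_ge0 w k x y : 0 <= dG f w k x y.
Proof. by apply: bigmax_ge_id. Qed.

Lemma dG_sym w k x y : dG f w k x y = dG f w k y x.
Proof. by apply: eq_bigr => i _; rewrite metric_sym. Qed.

Lemma dGxx w k x : dG f w k x x = 0.
Proof.
apply/eqP; rewrite eq_le dG_ge0 andbT; apply/dG_leP => // i _.
by rewrite mdistxx.
Qed.

Lemma dG_triangle w k y x z : dG f w k x z <= dG f w k x y + dG f w k y z.
Proof.
apply/dG_leP => [|i ik]; first by rewrite addr_ge0// dG_ge0.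
rewrite (le_trans (metric_triangle _ (fword f w i y) _))// lerD//.
  exact: (dG_leP w k x y (dG_ge0 w k x y)).1.
exact: (dG_leP w k y z (dG_ge0 w k y z)).1.
Qed.

Lemma eq_fword w w' k : (forall j, (j < k)%N -> w j = w' j) ->
  fword f w k = fword f w' k.
Proof.
elim: k => //= k IH ww'; rewrite IH ?ww'// => j jk.
by apply: ww'; rewrite ltnS ltnW.
Qed.

Lemma eq_dG w w' k : (forall j, (j < k)%N -> w j = w' j) ->
  dG f w k = dG f w' k.
Proof.
move=> ww'; apply/funext => x; apply/funext => y; apply: eq_bigr => i _.
by rewrite (@eq_fword w w')// => j ji; apply: ww'; exact: ltn_trans (ltn_ord i).
Qed.

(** The word that is left once the first [n] letters have been applied. *)
Definition shiftn n w := fun j => w (n + j)%N.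

Lemma fword_shiftn w n i x :
  fword f w (n + i) x = fword f (shiftn n w) i (fword f w n x).
Proof. by elim: i => [|i IH]; rewrite ?addn0// addnS /= IH. Qed.

Lemma shiftnD n k w : shiftn k (shiftn n w) = shiftn (n + k) w.
Proof. by apply/funext => j; rewrite /shiftn addnA. Qed.

(** Covers of the space by [N] sets of Bowen diameter at most [eps], encoded by
    choosing for each point a set that contains it: refining two covers is then
    pairing two colorings. *)
Definition colorable w k eps N : Prop :=
  exists (T : finType) (c : X -> T),
    #|T| = N /\ forall x y, c x = c y -> dG f w k x y <= eps.

Lemma colorable_gt0 w k eps N : colorable w k eps N -> (0 < N)%N.
Proof. by move=> [T [c [<- _]]]; apply/card_gt0P; exists (c point). Qed.

Lemma colorable0 w eps : 0 <= eps -> colorable w 0 eps 1.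
Proof.
move=> e0; exists unit, (fun=> tt); split; first exact: card_unit.
by move=> x y _; apply/dG_leP.
Qed.

(** Color a point by its color over the first [n] letters together with the color,
    for the shifted word, of the point it has been moved to. *)
Lemma colorableM w n k eps M N : 0 <= eps -> colorable w n eps M ->
  colorable (shiftn n w) k eps N -> colorable w (n + k) eps (M * N).
Proof.
move=> e0 [T1 [c1 [<- h1]]] [T2 [c2 [<- h2]]].
exists (T1 * T2)%type, (fun x => (c1 x, c2 (fword f w n x))).
split; first exact: card_prod.
move=> x y [/h1 /(dG_leP _ _ _ _ e0) d1 /h2 /(dG_leP _ _ _ _ e0) d2].
apply/dG_leP => // i ink; case: (ltnP i n) => [|ni]; first exact: d1.
rewrite -(subnKC ni) !fword_shiftn; apply: d2.
by rewrite ltn_subLR.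
Qed.

Lemma compact_colorable1 eps : compact [set: X] -> 0 < eps ->
  exists N, forall w, colorable w 1 eps N.
Proof.
move=> cX e0; have e20 : 0 < eps / 2 by rewrite divr_gt0.
move: cX; rewrite compact_cover => /(_ X setT (fun x => (ball x (eps / 2))^°)).
case=> [x _|x _|D _ Dcov].
- exact: open_interior.
- by exists x => //; exact: nbhsx_ballx.
have /choice[c cP] : forall x, exists d : D, mdist (val d) x < eps / 2.
  move=> x; have [d dD /interior_subset] := Dcov x Logic.I.
  by rewrite ballEmdist => dx; exists [` dD]%fset.
exists #|{: D}| => w; exists D, c; split => // x y cxy.
apply/dG_leP => [|i]; first exact: ltW.
rewrite ltnS leqn0 => /eqP ->/=.
rewrite (le_trans (metric_triangle _ (val (c x)) _))// [leRHS]splitr.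
rewrite lerD//; first by rewrite metric_sym ltW.
by rewrite cxy ltW.
Qed.

Lemma colorable_exp eps N : 0 <= eps -> (forall w, colorable w 1 eps N) ->
  forall w k, colorable w k eps (N ^ k).
Proof.
move=> e0 h w k; elim: k w => [|k IH] w; first exact: colorable0.
by rewrite expnS -add1n; apply: colorableM.
Qed.

(** Two points of a separated set never share a color. *)
Lemma card_separated_le w k eps N (E : {fset X}) :
  colorable w k eps N -> separated_set f w k eps E -> (#|` E| <= N)%N.
Proof.
move=> [T [c [<- cP]]] Esep.
rewrite -[#|` E|](size_map c) -(card_uniqP _) ?max_card//.
rewrite map_inj_in_uniq ?fset_uniq// => x y xE yE /cP dxy.
by apply/eqP/negPn/negP => /(Esep _ _ xE yE); rewrite ltNge dxy.
Qed.

(** A coloring bounds the cardinality of separated sets, so the supremum is reached;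
    a point far from all points of a largest separated set could be added to it. *)
Lemma max_separatedP w k eps N : 0 <= eps -> colorable w k eps N ->
  exists E : {fset X}, [/\ separated_set f w k eps E,
    forall x, exists2 e, e \in E & dG f w k e x <= eps,
    max_separated f w k eps = (#|` E|%:R)%:E & (0 < #|` E|)%N].
Proof.
move=> e0 colN.
pose Q n := `[< exists E, separated_set f w k eps E /\ #|` E| = n >].
have Q0 : exists n, Q n by exists 0; apply/asboolP; exists fset0; split.
have QN n : Q n -> (n <= N)%N.
  by move=> /asboolP[E [Esep <-]]; exact: card_separated_le colN Esep.
have [_ /asboolP[E [Esep <-]] Emax] := ex_maxnP Q0 QN.
have Espan x : exists2 e, e \in E & dG f w k e x <= eps.
  apply: contrapT => nx.
  have far e : e \in E -> eps < dG f w k e x.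
    by move=> eE; rewrite ltNge; apply/negP => ?; apply: nx; exists e.
  have xE : x \notin E.
    by apply/negP => /far; rewrite dGxx ltNge e0.
  suff /Emax : Q (#|` E|).+1 by rewrite ltnn.
  apply/asboolP; exists (x |` E)%fset; split; last by rewrite cardfsU1 xE.
  move=> a b /fset1UP[->|aE] /fset1UP[->|bE]; rewrite ?eqxx// => ab.
  - by rewrite dG_sym; exact: far.
  - exact: far.
  - exact: Esep.
exists E; split => //; last first.
  by have [e eE _] := Espan point; rewrite cardfs_gt0; apply/fset0Pn; exists e.
apply/eqP; rewrite eq_le; apply/andP; split.
  apply: ge_ereal_sup => _ [F Fsep <-]; rewrite lee_fin ler_nat.
  by apply: Emax; apply/asboolP; exists F.
by apply: ereal_sup_ubound; exists E.
Qed.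

(** Points attached to the same element of a maximal separated set are within
    [2 * eps] of each other, so such a set also colors the space. *)
Lemma max_separated_colorable w k eps N : 0 <= eps -> colorable w k eps N ->
  exists2 M, colorable w k (2 * eps) M & max_separated f w k eps = (M%:R)%:E.
Proof.
move=> e0 /(max_separatedP e0)[E [_ Espan -> _]]; exists #|` E| => //.
have /choice[c cP] : forall x, exists e : E, dG f w k (val e) x <= eps.
  by move=> x; have [e eE ?] := Espan x; exists [` eE]%fset.
exists E, c; split; first by rewrite cardfE.
move=> x y cxy; rewrite (le_trans (dG_triangle w k (val (c x)) x y))//.
rewrite mulr_natl mulr2n lerD//; first by rewrite dG_sym.
by rewrite cxy.
Qed.

Lemma max_separated_bounds w k eps N : 0 <= eps -> colorable w k eps N ->
  (1 <= max_separated f w k eps <= (N%:R)%:E)%E.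
Proof.
move=> e0 colN; have [E [Esep _ -> E0]] := max_separatedP e0 colN.
by rewrite !lee_fin ler1n E0 ler_nat (card_separated_le colN).
Qed.

Lemma max_separated_anti w k e1 e2 : e1 <= e2 ->
  (max_separated f w k e2 <= max_separated f w k e1)%E.
Proof.
move=> e12; apply: ereal_sup_le => _ [E Esep <-]; exists E => // x y xE yE xy.
exact: le_lt_trans e12 (Esep x y xE yE xy).
Qed.

End BowenDistance.

(** * Functions of finitely many letters and shift invariance *)

Section BernoulliShift.
Context {R : realType} {m : nat}.
Variables (p : 'I_m.+1 -> R) (P : probability (words m) R).
Implicit Types (w : nat -> 'I_m.+1) (n k : nat).
Local Open Scope ereal_scope.

Definition depends_on_prefix k (T : Type) (g : (nat -> 'I_m.+1) -> T) : Prop :=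
  forall w w', (forall j, (j < k)%N -> w j = w' j) -> g w = g w'.

Let word (a : seq 'I_m.+1) : nat -> 'I_m.+1 := nth ord0 a.

Let prefix_word k w (a : k.-tuple 'I_m.+1) : cylinder a w ->
  forall j, (j < k)%N -> w j = word a j.
Proof. by move=> aw j jk; apply: aw; rewrite size_tuple. Qed.

Let cylinder_prefix k w : cylinder [tuple w i | i < k] w.
Proof.
move=> j; rewrite size_tuple => jk.
by have := tnth_mktuple (fun i : 'I_k => w i) (Ordinal jk); rewrite (tnth_nth ord0).
Qed.

Let cylinder_inj k w (a : k.-tuple 'I_m.+1) : cylinder a w ->
  a = [tuple w i | i < k].
Proof.
move=> aw; apply: eq_from_tnth => i; rewrite tnth_mktuple (tnth_nth ord0).
by rewrite aw// size_tuple.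
Qed.

Lemma measurable_cylinder (a : seq 'I_m.+1) :
  measurable (cylinder a : set (words m)).
Proof. by apply: sub_sigma_algebra; exists a. Qed.

(** A preimage is the union of the finitely many cylinders of length [k] on which
    the value lies in the target. *)
Lemma measurable_prefix k (g : words m -> \bar R) :
  depends_on_prefix k g -> measurable_fun setT g.
Proof.
move=> gk _ Y mY; rewrite setTI.
rewrite (_ : g @^-1` Y =
    \bigcup_(a in [set a : k.-tuple 'I_m.+1 | Y (g (word a))])
       (cylinder a : set (words m))).
  apply: fin_bigcup_measurable => [|a _]; last exact: measurable_cylinder.
  exact: finite_finset.
apply/seteqP; split => w /=.
  have wc := @cylinder_prefix k w.
  move=> Yw; exists [tuple w i | i < k] => //=; rewrite -(gk w)//.
  exact: (prefix_word wc).
by case=> a /= Ya /prefix_word/gk ->.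
Qed.

Lemma integral_prefix k (g : words m -> \bar R) :
  is_bernoulli p P -> depends_on_prefix k g -> (forall w, 0 <= g w) ->
  \int[P]_w g w =
  \sum_(a : k.-tuple 'I_m.+1) (\prod_(i <- a) p i)%:E * g (word a).
Proof.
move=> Pp gk g0.
have gE w : g w = \sum_(a : k.-tuple 'I_m.+1)
    g (word a) * (\1_(cylinder a : set (words m)) w)%:E.
  rewrite (bigD1 [tuple w i | i < k])//= big1 => [|a aw].
    rewrite adde0 indicE mem_set ?mule1; last exact: cylinder_prefix.
    by apply: gk; exact: (prefix_word (cylinder_prefix (w := w))).
  rewrite indicE memNset ?mule0// => /cylinder_inj aw'.
  by rewrite aw' eqxx in aw.
under eq_integral do rewrite gE.
have mi (a : seq 'I_m.+1) :
    measurable_fun setT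
      (fun w : words m => (\1_(cylinder a : set (words m)) w)%:E : \bar R).
  by apply/measurable_EFinP; apply: measurable_indic; exact: measurable_cylinder.
rewrite ge0_integral_sum//; last 2 first.
- by move=> a; apply: measurable_funeM.
- by move=> a w _; rewrite mule_ge0// lee_fin.
apply: eq_bigr => a _; rewrite ge0_integralZl//.
rewrite integral_indic//; last exact: measurable_cylinder.
by rewrite setIT muleC; congr (_ * _); exact: Pp.
Qed.

Lemma depends_on_prefix_shiftn n k (T : Type) (g : (nat -> 'I_m.+1) -> T) :
  depends_on_prefix k g -> depends_on_prefix (n + k) (fun w => g (shiftn n w)).
Proof. by move=> gk w w' ww'; apply: gk => j jk; apply: ww'; rewrite ltn_add2l. Qed.

(** On cylinders of length [k.+1] the shift forgets the first letter, whose
    probabilities add up to 1. *)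
Lemma integral_shift1 k (g : words m -> \bar R) : is_bernoulli p P ->
  (forall i, 0 < p i)%R -> (\sum_i p i = 1)%R ->
  depends_on_prefix k g -> (forall w, 0 <= g w) ->
  \int[P]_w g (shiftn 1 w) = \int[P]_w g w.
Proof.
move=> Pp p0 p1 gk g0.
rewrite (integral_prefix Pp gk)//.
rewrite (integral_prefix Pp (depends_on_prefix_shiftn gk))//.
have pa0 (a : seq 'I_m.+1) : (0 <= \prod_(i <- a) p i)%R.
  by apply: prodr_ge0 => i _; rewrite ltW.
rewrite (reindex (fun q : 'I_m.+1 * k.-tuple 'I_m.+1 => [tuple of q.1 :: q.2]))/=;
  last first.
  exists (fun t => (thead t, behead_tuple t)) => [[i a] _|t _] /=.
    by rewrite theadE; congr pair; exact: val_inj.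
  by rewrite -tuple_eta.
rewrite -(pair_bigA _ (fun i (a : k.-tuple 'I_m.+1) =>
  (\prod_(j <- i :: a) p j)%:E * g (shiftn 1 (word (i :: a)))))/=.
rewrite exchange_big/=; apply: eq_bigr => a _.
transitivity (\sum_i (p i)%:E * ((\prod_(j <- a) p j)%:E * g (word a))).
  by apply: eq_bigr => i _; rewrite big_cons EFinM muleA.
rewrite -ge0_sume_distrl; last by move=> i _; rewrite lee_fin ltW.
by rewrite sumEFin p1 mul1e.
Qed.

Lemma integral_shiftn n k (g : words m -> \bar R) : is_bernoulli p P ->
  (forall i, 0 < p i)%R -> (\sum_i p i = 1)%R ->
  depends_on_prefix k g -> (forall w, 0 <= g w) ->
  \int[P]_w g (shiftn n w) = \int[P]_w g w.
Proof.
move=> Pp p0 p1 gk g0; elim: n => [//|n IH].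
rewrite -IH -(@integral_shift1 (n + k) (fun w => g (shiftn n w)))//.
exact: depends_on_prefix_shiftn.
Qed.

End BernoulliShift.

(** * Masses of Bowen balls and separated sets *)

Section LogarithmMonotone.
Context {R : realType}.
Implicit Types x y : \bar R.
Local Open Scope ereal_scope.

Lemma le_lne x y : 0 <= x -> x <= y -> lne x <= lne y.
Proof.
by move=> x0 xy; rewrite lee_lne// in_itv/= leey andbT// (le_trans x0).
Qed.

Lemma lne_pow (N k : nat) : (0 < N)%N ->
  lne ((N ^ k)%:R%:E : \bar R) = (k%:R * ln (N%:R : R))%:E.
Proof.
by move=> N0; rewrite natrX lne_EFin ?exprn_gt0 ?ltr0n// lnXn ?ltr0n// mulr_natl.
Qed.

(** For [y = +oo] the hypothesis says nothing, and the conclusion holds because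
    [1 <= z] makes [lne z] nonnegative, so that the right-hand side is [+oo]. *)
Lemma le_lneM x y z : 0 <= x -> 1 <= y -> 1 <= z -> x * y^-1 <= z ->
  lne x <= lne y + lne z.
Proof.
move=> x0; case: y => [y| |//] y1 z1.
  have y0 : (0 < y)%R by rewrite -lte_fin (lt_le_trans _ y1).
  rewrite inver gt_eqF// lee_pdivrMr// muleC => xyz.
  have z0 : 0 < z by rewrite (lt_le_trans _ z1).
  by rewrite -lneM ?in_itv/= ?leey ?andbT//; exact: le_lne.
by rewrite /= addye ?leey// gt_eqF// (lt_le_trans (@ltNy0 R))// lne_ge0.
Qed.

End LogarithmMonotone.

Section IntegralBounds.
Context d (T : measurableType d) (R : realType).
Variable mu : {measure set T -> \bar R}.
Local Open Scope ereal_scope.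

(** Monotonicity for functions that need not be measurable: the integral of a
    nonnegative function is a supremum over the simple functions below it. *)
Lemma le_integral_ge0 (g h : T -> \bar R) :
  (forall x, 0 <= g x) -> (forall x, g x <= h x) ->
  \int[mu]_x g x <= \int[mu]_x h x.
Proof.
move=> g0 gh; rewrite !ge0_integralTE//; last first.
  by move=> x; exact: le_trans (gh x).
apply: ereal_sup_le => _ [k /= kg <-]; exists k => //= x.
exact: le_trans (gh x).
Qed.

Lemma integral_sum_indic (I : Type) (s : seq I) (a : I -> \bar R)
    (B : I -> set T) :
  (forall i, measurable (B i)) -> (forall i, 0 <= a i) ->
  \int[mu]_x (\sum_(i <- s) a i * (\1_(B i) x)%:E) =
  \sum_(i <- s) a i * mu (B i).
Proof.
move=> mB a0.
have mi i : measurable_fun setT (fun x => (\1_(B i) x)%:E : \bar R).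
  by apply/measurable_EFinP; exact: measurable_indic.
rewrite ge0_integral_sum//; last 2 first.
- by move=> i; exact: measurable_funeM.
- by move=> i x _; rewrite mule_ge0// lee_fin.
by apply: eq_bigr => i _; rewrite ge0_integralZl// integral_indic// setIT.
Qed.

End IntegralBounds.

Section BowenBalls.
Context {R : realType} {X : pmetricType R} {m : nat}.
Variables (f : 'I_m.+1 -> X -> X) (mu : probability (borelType X) R).
Hypothesis cf : forall i, continuous (f i).
Hypothesis mu_full : full_support mu.
Implicit Types (w : nat -> 'I_m.+1) (n k : nat) (x y : X) (eps r : R).

Lemma continuous_fword w k : continuous (fword f w k).
Proof.
elim: k => [|k IH] x /=; first exact: cvg_id.
by apply: continuous_comp; [exact: IH|exact: cf].
Qed.

Lemma closed_mdist_le x eps : closed [set y | mdist x y <= eps].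
Proof.
rewrite -[X in closed X]setCK closedC openE => y /= /negP; rewrite -ltNge => xy.
apply/nbhs_ballP; exists (mdist x y - eps) => /=; first by rewrite subr_gt0.
move=> z; rewrite ballEmdist/= ltrBrDr => yz xz.
have := metric_triangle x z y; rewrite [mdist z y]metric_sym leNgt => /negP; apply.
by rewrite (le_lt_trans _ yz)// addrC lerD2l.
Qed.

Lemma BG_bigcap w k x eps : 0 <= eps -> BG f w k x eps =
  \bigcap_(i in [set i | (i < k)%N])
    fword f w i @^-1` [set z | mdist (fword f w i x) z <= eps].
Proof.
by move=> e0; apply/seteqP; split => y; rewrite /BG/= => /(dG_leP _ _ _ _ _ e0).
Qed.

Lemma measurable_BG w k x eps : 0 <= eps ->
  measurable (BG f w k x eps : set (borelType X)).
Proof.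
move=> e0; rewrite -[X in measurable X]setCK; apply: measurableC.
apply: sub_sigma_algebra; rewrite openC BG_bigcap//; apply: closed_bigI => i _.
have /continuous_closedP := @continuous_fword w i; apply.
exact: closed_mdist_le.
Qed.

(** By continuity of the finitely many maps involved, a Bowen ball is a
    neighborhood of its centre, which a measure of full support charges. *)
Lemma mu_BG_gt0 w k x eps : 0 < eps -> (0 < mu (BG f w k x eps))%E.
Proof.
move=> e0; have e0' := ltW e0.
have BGx : nbhs x (BG f w k x eps).
  rewrite BG_bigcap//; elim: k => [|k IH]; first by apply: filterS filterT => y _ i.
  have : nbhs x (fword f w k @^-1` [set z | mdist (fword f w k x) z <= eps]).
    apply: (@continuous_fword w k x); apply/nbhs_ballP; exists eps => //= z.
    by rewrite ballEmdist => /ltW.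
  apply: filterS2 IH => y yk ykk i /=; rewrite ltnS leq_eqVlt => /predU1P[->//|].
  exact: yk.
have := @mu_full (BG f w k x eps)^° (@open_interior _ _).
move=> /(_ (ex_intro _ x BGx)) /lt_le_trans; apply; apply: le_measure.
- by rewrite inE; apply: sub_sigma_algebra; exact: open_interior.
- by rewrite inE; exact: measurable_BG.
- exact: interior_subset.
Qed.

Lemma mu_BG_real w k x eps : 0 < eps ->
  exists2 b : R, 0 < b <= 1 & mu (BG f w k x eps) = b%:E.
Proof.
move=> e0; have mB := measurable_BG w k x (ltW e0).
have := mu_BG_gt0 w k x e0; have := probability_le1 mu mB.
case: (mu _) => [b||//]; last by rewrite leye_eq.
by rewrite !lee_fin lte_fin => b1 b0; exists b => //; rewrite b0.
Qed.

Lemma mu_BG_inv_ge0 w k x eps : 0 < eps -> (0 <= (mu (BG f w k x eps))^-1)%E.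
Proof. by move=> e0; rewrite inve_ge0 measure_ge0. Qed.

Lemma BG_inv_anti w w' k k' x y e1 e2 : 0 < e1 -> 0 < e2 ->
  BG f w k x e1 `<=` BG f w' k' y e2 ->
  ((mu (BG f w' k' y e2))^-1 <= (mu (BG f w k x e1))^-1)%E.
Proof.
move=> e10 e20 BB; rewrite lee_pV2 ?inE ?measure_ge0//.
by apply: le_measure => //; rewrite inE; apply: measurable_BG; exact: ltW.
Qed.

Lemma sub_BG w k x y e1 e2 : BG f w k x e1 y ->
  BG f w k x e2 `<=` BG f w k y (e1 + e2).
Proof.
rewrite /BG/= => xy z /= xz; rewrite (le_trans (dG_triangle f w k x y z))// lerD//.
by rewrite dG_sym.
Qed.

Lemma integral_sum_BG w k eps (E : seq X) (a : X -> \bar R) : 0 < eps ->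
  (forall e, 0 <= a e)%E ->
  (\int[mu]_x (\sum_(e <- E) a e * (\1_(BG f w k e eps : set (borelType X)) x)%:E)
   = \sum_(e <- E) a e * mu (BG f w k e eps))%E.
Proof.
move=> e0 a0; apply: integral_sum_indic => // e.
by apply: measurable_BG; exact: ltW.
Qed.

Definition inverse_mass w k eps : \bar R :=
  (\int[mu]_x (mu (BG f w k x eps))^-1)%E.

Lemma inverse_mass_ge1 w k eps : 0 < eps -> (1 <= inverse_mass w k eps)%E.
Proof.
move=> e0; rewrite -(probability_setT mu) -[leLHS]mul1e -integral_cst//.
apply: le_integral_ge0 => // x; rewrite inve_ge1//.
by apply: probability_le1; apply: measurable_BG; exact: ltW.
Qed.

(** The integrand is at most the sum, over the points [e] of a maximal separated
    set, of the inverse mass of the ball at [e] carried by that ball: if [x] is in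
    the ball of radius [eps] at [e], that ball lies in the ball of radius [2 * eps]
    at [x].  Each summand has integral 1. *)
Lemma inverse_mass_le_max_separated w k eps N : 0 < eps -> colorable f w k eps N ->
  (inverse_mass w k (2 * eps) <= max_separated f w k eps)%E.
Proof.
move=> e0 /(max_separatedP (ltW e0))[E [_ Espan -> _]].
have e20 : 0 < 2 * eps by rewrite mulr_gt0.
pose a e := ((mu (BG f w k e eps))^-1)%E.
have a0 e : (0 <= a e)%E by exact: mu_BG_inv_ge0.
have -> : ((#|` E|%:R)%:E = \int[mu]_x
    (\sum_(e <- E) a e * (\1_(BG f w k e eps : set (borelType X)) x)%:E))%E.
  rewrite integral_sum_BG// (eq_bigr (fun=> 1%E)) => [|e _].
    by rewrite sumEFin big_const_seq count_predT iter_addr_0.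
  rewrite /a; have [b /andP[b0 _] ->] := mu_BG_real w k e e0.
  by rewrite inver gt_eqF// -EFinM mulVf// gt_eqF.
apply: le_integral_ge0 => [x|x]; first exact: mu_BG_inv_ge0.
have [e eE xe] := Espan x.
rewrite (bigD1_seq e) ?fset_uniq//=.
rewrite indicE mem_set// mule1 (le_trans _ (leeDl _ _))//; last first.
  by apply: sume_ge0 => i _; rewrite mule_ge0// lee_fin.
apply: BG_inv_anti => //; rewrite mulr_natl mulr2n; exact: sub_BG.
Qed.

Definition doubling_ratio w k eps : \bar R :=
  ereal_sup [set (mu (BG f w k x (2 * eps)) / mu (BG f w k x eps))%E
            | x in [set: X]].

Lemma le_doubling_ratio w k x eps :
  (mu (BG f w k x (2 * eps)) / mu (BG f w k x eps) <= doubling_ratio w k eps)%E.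
Proof. by apply: ereal_sup_ubound; exists x. Qed.

Lemma doubling_ratio_ge1 w k eps : 0 < eps -> (1 <= doubling_ratio w k eps)%E.
Proof.
move=> e0; apply: le_trans (le_doubling_ratio w k point eps).
have e20 : 0 < 2 * eps by rewrite mulr_gt0.
have : (mu (BG f w k point eps) <= mu (BG f w k point (2 * eps)))%E.
  apply: le_measure; rewrite ?inE; try (apply: measurable_BG; exact: ltW).
  move=> y /le_trans; apply; rewrite mulr_natl mulr2n lerDl; exact: ltW.
have [b /andP[b0 _] ->] := mu_BG_real w k point e0.
have [c /andP[c0 _] ->] := mu_BG_real w k point e20.
by rewrite inver gt_eqF// -EFinM !lee_fin ler_pdivlMr// mul1r.
Qed.

(** The integrand dominates the sum, over the points [e] of a separated set, of the
    inverse mass of the ball of radius [2 * eps] at [e] carried by the ball of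
    radius [eps] at [e]: these small balls are disjoint, and a ball of radius [eps]
    centred in one of them lies in the large ball.  Each summand has integral at
    least the inverse of the doubling ratio. *)
Lemma max_separated_le_doubling w k eps N : 0 < eps ->
  colorable f w k (2 * eps) N ->
  (lne (max_separated f w k (2 * eps)) <=
   lne (doubling_ratio w k eps) + lne (inverse_mass w k eps))%E.
Proof.
move=> e0; have e20 : 0 < 2 * eps by rewrite mulr_gt0.
move=> /(max_separatedP (ltW e20))[E [Esep _ -> _]].
apply: le_lneM; [by rewrite lee_fin|exact: doubling_ratio_ge1
                |exact: inverse_mass_ge1|].
pose a e := ((mu (BG f w k e (2 * eps)))^-1)%E.
have a0 e : (0 <= a e)%E by exact: mu_BG_inv_ge0.
apply: (@le_trans _ _ (\int[mu]_x
    (\sum_(e <- E) a e * (\1_(BG f w k e eps : set (borelType X)) x)%:E))%E).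
  rewrite integral_sum_BG//.
  apply: (@le_trans _ _ (\sum_(e <- E) (doubling_ratio w k eps)^-1)%E).
    by rewrite big_const_seq count_predT iter_addr_0 mule_natl.
  apply: lee_sum => e _; rewrite /a.
  have := le_doubling_ratio w k e eps.
  have [b /andP[b0 _] ->] := mu_BG_real w k e e0.
  have [c /andP[c0 _] ->] := mu_BG_real w k e e20.
  rewrite !inver !gt_eqF// -!EFinM => le_D.
  rewrite -[leRHS](_ : ((c / b)%:E)^-1 = _)%E.
    rewrite lee_pV2// inE ?lee_fin ?divr_ge0// ltW//.
    by apply: lt_le_trans le_D; rewrite lte_fin divr_gt0.
  by rewrite inver gt_eqF ?divr_gt0// invf_div mulrC.
apply: le_integral_ge0 => x.
  by apply: sume_ge0 => i _; rewrite mule_ge0// lee_fin.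
have [[e [eE ex]]|nE] := pselect (exists e, e \in E /\ BG f w k e eps x).
  rewrite (bigD1_seq e) ?fset_uniq//=.
  rewrite indicE mem_set// mule1 big1_seq ?adde0.
    apply: BG_inv_anti => //; rewrite mulr_natl mulr2n; apply: sub_BG.
    by rewrite /BG/= dG_sym.
  move=> i /andP[ie iE]; rewrite indicE memNset ?mule0// => ix.
  have := Esep _ _ iE eE ie; rewrite ltNge => /negP; apply.
  rewrite (le_trans (dG_triangle f w k x i e))// mulr_natl mulr2n lerD//.
  by rewrite dG_sym.
rewrite big1_seq => [|i /andP[_ iE]]; first exact: mu_BG_inv_ge0.
by rewrite indicE memNset ?mule0// => ix; apply: nE; exists i.
Qed.

End BowenBalls.

(** * Growth rates averaged over words *)

Section AveragedGrowth.
Context {R : realType} {X : pmetricType R} {m : nat}.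
Variables (f : 'I_m.+1 -> X -> X) (p : 'I_m.+1 -> R).
Variables (P : probability (words m) R) (mu : probability (borelType X) R).
Hypothesis cX : compact [set: X].
Hypothesis cf : forall i, continuous (f i).
Hypothesis p_gt0 : forall i, 0 < p i.
Hypothesis p_sum1 : \sum_i p i = 1.
Hypothesis Pp : is_bernoulli p P.
Hypothesis mu_full : full_support mu.
Implicit Types (w : nat -> 'I_m.+1) (n k : nat) (eps : R).
Local Open Scope ereal_scope.

Lemma prefix_max_separated k eps :
  depends_on_prefix k (fun w => lne (max_separated f w k eps)).
Proof. by move=> w w' ww'; rewrite /max_separated /separated_set (eq_dG f ww'). Qed.

Lemma prefix_inverse_mass k eps :
  depends_on_prefix k (fun w => lne (inverse_mass f mu w k eps)).
Proof. by move=> w w' ww'; rewrite /inverse_mass /BG (eq_dG f ww'). Qed.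

Lemma prefix_doubling_ratio k eps :
  depends_on_prefix k (fun w => lne (doubling_ratio f mu w k eps)).
Proof. by move=> w w' ww'; rewrite /doubling_ratio /BG (eq_dG f ww'). Qed.

Lemma colorable_exists eps : (0 < eps)%R ->
  exists2 N, (0 < N)%N & forall w k, colorable f w k eps (N ^ k).
Proof.
move=> e0; have [N colN] := compact_colorable1 f cX e0.
exists N; first exact: (colorable_gt0 (colN (fun=> ord0))).
by move=> w k; apply: colorable_exp => //; exact: ltW.
Qed.

Lemma lne_max_separated_ge0 w k eps : (0 < eps)%R ->
  0 <= lne (max_separated f w k eps).
Proof.
move=> e0; have [N _ colN] := colorable_exists e0.
by rewrite lne_ge0; have /andP[] := max_separated_bounds (ltW e0) (colN w k).
Qed.

(** The linear bound in [k] comes from a cover of the space by small balls, which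
    serves every letter of every word; it is what makes the truncated doubling
    terms dominated. *)
Lemma lne_max_separated_le eps : (0 < eps)%R ->
  exists2 c : R, (0 <= c)%R &
    forall w k, lne (max_separated f w k eps) <= (k%:R * c)%:E.
Proof.
move=> e0; have [N N0 colN] := colorable_exists e0.
exists (ln N%:R) => [|w k]; first by rewrite ln_ge0// ler1n.
rewrite -lne_pow//.
have /andP[s1 sN] := max_separated_bounds (ltW e0) (colN w k).
by apply: le_lne => //; exact: le_trans s1.
Qed.

Definition separated_growth k eps : \bar R :=
  \int[P]_w lne (max_separated f w k eps).

Lemma separated_growth_real k eps : (0 < eps)%R ->
  exists2 s : R, (0 <= s)%R & separated_growth k eps = s%:E.
Proof.
move=> e0; have s0 : 0 <= separated_growth k eps.
  by apply: integral_ge0 => w _; exact: lne_max_separated_ge0.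
have [c c0 le_c] := lne_max_separated_le e0.
have : separated_growth k eps <= (k%:R * c)%:E.
  apply: le_trans (_ : \int[P]_w (k%:R * c)%:E <= _).
    by apply: le_integral_ge0 => // w; exact: lne_max_separated_ge0.
  by rewrite integral_cst// [X in _ * X]probability_setT mule1.
case: (separated_growth k eps) s0 => [s| |]//.
by rewrite lee_fin => s0 _; exists s.
Qed.

Lemma separated_growth_anti k e1 e2 : (0 < e1)%R -> (e1 <= e2)%R ->
  separated_growth k e2 <= separated_growth k e1.
Proof.
move=> e10 e12; have e20 := lt_le_trans e10 e12.
apply: le_integral_ge0 => w; first exact: lne_max_separated_ge0.
apply: le_lne; last exact: max_separated_anti.
by rewrite (@le_trans _ _ 1)// -lne_ge0 lne_max_separated_ge0.
Qed.

(** Cut a word of length [q * n + r] into [q] blocks of length [n], colored by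
    maximal separated sets, and a remainder colored letter by letter. *)
Lemma colorable_blocks n r eps N : (0 < eps)%R -> (0 < N)%N ->
  (forall w k, colorable f w k (2 * eps) (N ^ k)) ->
  forall q w, exists2 M, colorable f w (q * n + r) (2 * eps) M &
    lne (M%:R)%:E <= \sum_(j < q) lne (max_separated f (shiftn (j * n) w) n eps)
                     + (r%:R * ln (N%:R : R))%:E.
Proof.
move=> e0 N0 colN; have e20 : (0 <= 2 * eps)%R by rewrite mulr_ge0// ltW.
elim=> [|q IH] w.
  by exists (N ^ r)%N => //; rewrite big_ord0 add0e lne_pow.
have [N' _ colN'] := colorable_exists e0.
have [M1 col1 M1E] := max_separated_colorable (ltW e0) (colN' w n).
have [M2 col2 le2] := IH (shiftn n w).
exists (M1 * M2)%N; first by rewrite mulSn -addnA; exact: colorableM.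
have M10 := colorable_gt0 col1; have M20 := colorable_gt0 col2.
have -> : lne ((M1 * M2)%:R%:E : \bar R) = lne M1%:R%:E + lne M2%:R%:E.
  by rewrite natrM EFinM lneM// in_itv/= leey andbT lte_fin ltr0n.
rewrite -M1E big_ord_recl mul0n -addeA; apply: leeD => //.
apply: le_trans le2 _; rewrite leeD2r//; apply: lee_sum => j _.
by rewrite shiftnD mulSn.
Qed.

(** All blocks contribute the same average, by shift invariance. *)
Lemma separated_growth_blocks eps : (0 < eps)%R ->
  exists2 c : R, (0 <= c)%R & forall q n r,
    separated_growth (q * n + r) (2 * eps) <=
    q%:R%:E * separated_growth n eps + (r%:R * c)%:E.
Proof.
move=> e0; have e20 : (0 < 2 * eps)%R by rewrite mulr_gt0.
have [N N0 colN] := colorable_exists e20.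
have c0 : (0 <= ln (N%:R : R))%R by rewrite ln_ge0// ler1n.
exists (ln N%:R) => // q n r.
pose g j w := lne (max_separated f (shiftn j w) n eps).
have g0 j w : 0 <= g j w by exact: lne_max_separated_ge0.
have mg j : measurable_fun [set: words m] (g j).
  apply: (@measurable_prefix _ _ (j + n)).
  by apply: (depends_on_prefix_shiftn (@prefix_max_separated n eps)).
apply: (@le_trans _ _ (\int[P]_w
    (\sum_(j < q) g (j * n)%N w + (r%:R * ln (N%:R : R))%:E))).
  apply: le_integral_ge0 => w; first exact: lne_max_separated_ge0.
  have [M colM leM] := colorable_blocks n r e0 N0 colN q w.
  apply: le_trans leM; have /andP[s1 sM] := max_separated_bounds (ltW e20) colM.
  by apply: le_lne => //; exact: le_trans s1.
have sum0 w : 0 <= \sum_(j < q) g (j * n)%N w by apply: sume_ge0.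
have msum : measurable_fun [set: words m] (fun w => \sum_(j < q) g (j * n)%N w).
  by apply: emeasurable_sum => j.
rewrite ge0_integralD//; last by move=> w _; rewrite lee_fin mulr_ge0.
rewrite integral_cst// [X in _ + _ * X]probability_setT mule1 leeD2r//.
rewrite ge0_integral_sum// (eq_bigr (fun=> separated_growth n eps)) => [|j _].
  by rewrite big_const_ord iter_addr_0 mule_natl.
exact: (integral_shiftn _ Pp p_gt0 p_sum1 (@prefix_max_separated n eps)
  (fun w => lne_max_separated_ge0 w n e0)).
Qed.

(** The Fekete argument: divide by [k] the bound for [k = (k %/ n) * n + k %% n]. *)
Lemma limsup_growth_le n eps : (0 < eps)%R -> (0 < n)%N ->
  limn_esup (fun k => (k%:R^-1)%:E * separated_growth k (2 * eps)) <=
  (n%:R^-1)%:E * separated_growth n eps.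
Proof.
move=> e0 n0; have [c c0 blocks] := separated_growth_blocks e0.
have [s s0 sE] := separated_growth_real n e0.
rewrite sE -EFinM -(cvg_limn_einf_sup (cvg_cst (n%:R^-1 * s)%:E)).2.
apply: le_limn_esup => d d0.
have nR0 : (0 < n%:R :> R)%R by rewrite ltr0n.
near=> k.
have k0 : (0 < k%:R :> R)%R by rewrite ltr0n; near: k; exact: nbhs_infty_gt.
have := blocks (k %/ n)%N n (k %% n)%N; rewrite -divn_eq sE => le_k.
apply: (@le_trans _ _ ((k%:R^-1)%:E *
    ((k %/ n)%:R%:E * s%:E + ((k %% n)%:R * c)%:E))).
  by rewrite lee_wpmul2l// lee_fin invr_ge0 ltW.
rewrite -!(EFinM, EFinD) lee_fin mulrDr lerD//.
  rewrite mulrA ler_wpM2r// ler_pdivrMl// ler_pdivlMr// -natrM ler_nat.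
  exact: leq_trunc_div.
rewrite ler_pdivrMl//; apply: (@le_trans _ _ (n%:R * c)%R).
  by rewrite ler_wpM2r// ler_nat ltnW// ltn_mod.
by rewrite -ler_pdivrMr//; near: k; exact: nbhs_infty_ger.
Unshelve. all: by end_near. Qed.

(** The bound by the average over one block holds for every block length, so also
    for the lower limit over block lengths. *)
Lemma limsup_growth_le_liminf eps : (0 < eps)%R ->
  limn_esup (fun k => (k%:R^-1)%:E * separated_growth k (2 * eps)) <=
  limn_einf (fun k => (k%:R^-1)%:E * separated_growth k eps).
Proof.
move=> e0.
(* The left side becomes the lower limit, over block lengths, of a constant. *)
rewrite -[leLHS](cvg_limn_einf_sup (cvg_cst (limn_esup _))).1.
apply: le_limn_einf => d d0; near=> n.
rewrite (le_trans (limsup_growth_le e0 (_ : 0 < n)%N))//; last first.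
  by rewrite leeDl// lee_fin ltW.
by near: n; exact: nbhs_infty_gt.
Unshelve. all: by end_near. Qed.

Lemma cor_integral_le_growth k eps : (0 < eps)%R ->
  cor_integral f P mu k (2 * eps) <= separated_growth k eps.
Proof.
move=> e0; have e20 : (0 < 2 * eps)%R by rewrite mulr_gt0.
have [N _ colN] := colorable_exists e0.
have I1 w : 1 <= inverse_mass f mu w k (2 * eps) by exact: inverse_mass_ge1.
apply: le_integral_ge0 => w; first by rewrite lne_ge0; exact: I1.
apply: le_lne; first by apply: le_trans (I1 w).
exact: inverse_mass_le_max_separated (colN w k).
Qed.

Lemma limsup_cor_le_growth eps : (0 < eps)%R ->
  limn_esup (fun k => (k%:R^-1)%:E * cor_integral f P mu k (2 * eps)) <=
  limn_esup (fun k => (k%:R^-1)%:E * separated_growth k eps).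
Proof.
move=> e0; apply: le_limn_esup => d d0; apply: nearW => k.
apply: (@le_trans _ _ ((k%:R^-1)%:E * separated_growth k eps)).
  by rewrite lee_wpmul2l ?lee_fin ?invr_ge0//; exact: cor_integral_le_growth.
by rewrite leeDl// lee_fin ltW.
Qed.

(** The doubling term, cut at the bound [c] on the growth rate of separated sets.
    Without the cut its average over words need not tend to 0. *)
Let truncated_doubling (c eps : R) k w : \bar R :=
  mine ((k%:R^-1)%:E * lne (doubling_ratio f mu w k eps)) c%:E.

Let truncated_doubling_ge0 c eps k w : (0 < eps)%R -> (0 <= c)%R ->
  0 <= truncated_doubling c eps k w.
Proof.
move=> e0 c0; rewrite le_min lee_fin c0 andbT mule_ge0 ?lee_fin ?invr_ge0//.
by rewrite lne_ge0; exact: doubling_ratio_ge1.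
Qed.

Let measurable_truncated_doubling c eps k :
  measurable_fun [set: words m] (truncated_doubling c eps k).
Proof.
apply: (@measurable_prefix _ _ k) => w w' ww'.
by rewrite /truncated_doubling (prefix_doubling_ratio _ ww').
Qed.

Lemma truncated_doubling_cvg0 c eps : (0 < eps)%R -> (0 <= c)%R ->
  {ae P, forall w, limn_esup (fun k =>
    (k%:R^-1)%:E * lne (doubling_ratio f mu w k eps)) = 0} ->
  \int[P]_w truncated_doubling c eps k w @[k --> \oo] --> 0.
Proof.
move=> e0 c0 dbl.
have [] // := @dominated_convergence _ _ _ P setT measurableT
    (truncated_doubling c eps) (cst 0) (cst c%:E).
- apply: (@filterS _ _ (ae_filter_ringOfSetsType P)) dbl => w dw _.
  have D0 k : 0 <= (k%:R^-1)%:E * lne (doubling_ratio f mu w k eps).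
    rewrite mule_ge0 ?lee_fin ?invr_ge0//.
    by rewrite lne_ge0; exact: doubling_ratio_ge1.
  have Dcvg : (k%:R^-1)%:E * lne (doubling_ratio f mu w k eps) @[k --> \oo] --> 0.
    by apply: limn_esup_le_cvg => //; rewrite dw.
  apply: (squeeze_cvge _ (cvg_cst 0) Dcvg); apply: nearW => k.
  by rewrite truncated_doubling_ge0//= ge_min lexx.
- exact: finite_measure_integrable_cst.
- apply: aeW => w k _; rewrite gee0_abs ?truncated_doubling_ge0//.
  by rewrite ge_min lexx orbT.
by move=> _ _; rewrite integral0.
Qed.

(** Where the doubling term exceeds the cut [c], the growth rate of separated sets is
    already at most [c], and the logarithm of the inverse mass, being nonnegative,
    can be added to the bound. *)
Lemma liminf_growth_le_cor eps : (0 < eps)%R ->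
  {ae P, forall w, limn_esup (fun k =>
    (k%:R^-1)%:E * lne (doubling_ratio f mu w k eps)) = 0} ->
  limn_einf (fun k => (k%:R^-1)%:E * separated_growth k (2 * eps)) <=
  limn_einf (fun k => (k%:R^-1)%:E * cor_integral f P mu k eps).
Proof.
move=> e0 dbl; have e20 : (0 < 2 * eps)%R by rewrite mulr_gt0.
have [c c0 le_c] := lne_max_separated_le e20.
have [N _ colN] := colorable_exists e20.
have I0 k w : 0 <= lne (inverse_mass f mu w k eps).
  by rewrite lne_ge0; exact: inverse_mass_ge1.
have mI k : measurable_fun [set: words m] (fun w => lne (inverse_mass f mu w k eps)).
  exact: measurable_prefix (@prefix_inverse_mass k eps).
have mS k : measurable_fun [set: words m] (fun w => lne (max_separated f w k (2 * eps))).
  exact: measurable_prefix (@prefix_max_separated k _).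
have S_le k w : (k%:R^-1)%:E * lne (max_separated f w k (2 * eps)) <=
    (k%:R^-1)%:E * lne (inverse_mass f mu w k eps) + truncated_doubling c eps k w.
  have k0 : 0 <= (k%:R^-1 : R)%:E by rewrite lee_fin invr_ge0.
  rewrite /truncated_doubling minEle; case: ifP => _.
    rewrite addeC -ge0_muleDr//; last by rewrite lne_ge0; exact: doubling_ratio_ge1.
    by rewrite lee_wpmul2l//; exact: max_separated_le_doubling (colN w k).
  apply: (@le_trans _ _ c%:E); last by rewrite leeDr// mule_ge0.
  apply: le_trans (lee_wpmul2l k0 (le_c w k)) _; rewrite -EFinM lee_fin mulrA.
  have [->|k_neq0] := eqVneq k 0%N; first by rewrite mulr0 mul0r.
  by rewrite mulVf ?mul1r// pnatr_eq0.
have /fine_cvgP[Tfin /cvgrPdist_le T0] := truncated_doubling_cvg0 e0 c0 dbl.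
apply: le_limn_einf => d d0; near=> k.
have k0 : 0 <= (k%:R^-1 : R)%:E by rewrite lee_fin invr_ge0.
have T_le : \int[P]_w truncated_doubling c eps k w <= d%:E.
  have Tk : \int[P]_w truncated_doubling c eps k w \is a fin_num by near: k.
  rewrite -(fineK Tk) lee_fin (le_trans (ler_norm _))// -[leLHS]normrN -sub0r.
  by near: k; exact: T0.
apply: (@le_trans _ _ (\int[P]_w ((k%:R^-1)%:E * lne (inverse_mass f mu w k eps)
    + truncated_doubling c eps k w))).
  have S0 w := lne_max_separated_ge0 w k e20.
  rewrite /separated_growth -ge0_integralZl//.
  by apply: le_integral_ge0 => // w; rewrite mule_ge0.
have kI0 w : 0 <= (k%:R^-1)%:E * lne (inverse_mass f mu w k eps).
  by rewrite mule_ge0.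
have kT0 w : 0 <= truncated_doubling c eps k w by exact: truncated_doubling_ge0.
have mkI : measurable_fun [set: words m]
    (fun w => (k%:R^-1)%:E * lne (inverse_mass f mu w k eps)).
  exact: measurable_funeM.
rewrite ge0_integralD//.
by rewrite ge0_integralZl// leeD2l.
Unshelve. all: by end_near. Qed.

End AveragedGrowth.

Theorem theorem1p2 (R : realType) (X : pmetricType R) (m : nat)
    (f : 'I_m.+1 -> X -> X) (p : 'I_m.+1 -> R)
    (P : probability (words m) R) (mu : probability (borelType X) R) :
  compact [set: X] ->
  (forall i, continuous (f i)) ->
  (forall i, 0 < p i) ->
  \sum_i p i = 1 ->
  is_bernoulli p P ->
  full_support mu ->
  weak_entropy_doubling f P mu ->
  exists2 h : \bar R, is_hcor f P mu h & htop f P = h.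
Proof.
move=> cX cf p0 p1 Pp mu_full dbl.
pose s eps := limn_einf (fun k => ((k%:R^-1)%:E * separated_growth f P k eps)%E).
have s_anti : {in Interval (BRight (0 : R)) (BInfty _ false) &,
    nonincreasing_fun s}.
  move=> e1 e2; rewrite !in_itv/= !andbT => e10 e20 e12.
  apply: le_limn_einf => d d0; apply: nearW => k.
  apply: (@le_trans _ _ ((k%:R^-1)%:E * separated_growth f P k e1)%E).
    by rewrite lee_wpmul2l ?lee_fin ?invr_ge0//; exact: separated_growth_anti.
  by rewrite leeDl// lee_fin ltW.
have := @nonincreasing_at_right_cvge R s 0 (BInfty _ false) isT s_anti.
set h := ereal_sup _ => s_cvg.
(* The scales lost in the three comparisons: a factor 2 between separated sets and
   the lower correlation rate, and 2 twice between the upper one and [s]. *)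
have s2 : s (2 * e) @[e --> 0^'+] --> h by exact: cvg_at_right_scale s_cvg.
have q0 : 0 < 4^-1 :> R by rewrite invr_gt0 ltr0n.
have s4 : s (4^-1 * e) @[e --> 0^'+] --> h by exact: cvg_at_right_scale q0 s_cvg.
pose U eps := limn_esup (fun k => ((k%:R^-1)%:E * cor_integral f P mu k eps)%E).
pose L eps := limn_einf (fun k => ((k%:R^-1)%:E * cor_integral f P mu k eps)%E).
have LU eps : (L eps <= U eps)%E by exact: limn_einf_sup.
have sL : \forall e \near 0^'+, (s (2 * e)%R <= L e)%E.
  near=> e; have e0 : 0 < e by near: e; exact: nbhs_right_gt.
  apply: liminf_growth_le_cor => //; near: e; exact: dbl.
have Us : \forall e \near 0^'+, (U e <= s (4^-1 * e)%R)%E.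
  near=> e; have e0 : 0 < e by near: e; exact: nbhs_right_gt.
  have e40 : 0 < 4^-1 * e := mulr_gt0 q0 e0.
  apply: le_trans (limsup_growth_le_liminf f cX p0 p1 Pp e40).
  rewrite [in leLHS](_ : e = 2 * (2 * (4^-1 * e))); last first.
    by rewrite !mulrA -natrM divff// mul1r.
  by apply: limsup_cor_le_growth => //; rewrite mulr_gt0.
have L_cvg : L e @[e --> 0^'+] --> h.
  apply: (squeeze_cvge _ s2 s4); apply: filterS2 sL Us => e sLe eUs.
  by apply/andP; split; [exact: sLe|exact: le_trans (LU e) eUs].
have U_cvg : U e @[e --> 0^'+] --> h.
  apply: (squeeze_cvge _ s2 s4); apply: filterS2 sL Us => e sLe eUs.
  by apply/andP; split; [exact: le_trans sLe (LU e)|exact: eUs].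
exists h; last exact: cvg_lim s_cvg.
by split; [exact: cvg_lim U_cvg|exact: cvg_lim L_cvg].
Unshelve. all: by end_near. Qed.
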